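(* Let $K$ be a plane convex body. Then the following hold. (1) $K$ is strongly invariant if and only if its central symmetral $\frac{1}{2}(K-K)$ has a $4$-fold rotational symmetry. (2) Up to similarity, the affine class $\mathrm{AFF}(K)$ of $K$ contains at most one strongly invariant element; that is, any two strongly invariant elements of $\mathrm{AFF}(K)$ are similar to each other.
   Context: A plane convex body is a compact convex subset of $\mathbb{R}^2$ with nonempty interior. A rectangle $R$ (with arbitrary orientation) is circumscribed about $K$ if $K\subseteq R$ and every side of $R$ contains a point of $K$. A plane convex body $K$ is strongly invariant if every rectangle circumscribed about $K$ is a square. $\frac12(K-K)=\{\frac12(p-q): p,q\in K\}$; it is symmetric about the origin $o$. A body that is symmetric about $o$ has a $4$-fold rotational symmetry if it is mapped onto itself by the rotation about $o$ by angle $\frac{\pi}{2}$. $\mathrm{AFF}(K)$ is the family of all plane convex bodies that are affine copies of $K$, i.e. images of $K$ under invertible affine maps of $\mathbb{R}^2$. Two bodies are similar if one is the image of the other under a similarity of the plane (possibly orientation-reversing). *)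

(* Defs.v *)
From mathcomp Require Import all_boot all_order all_algebra.
From mathcomp Require Import all_classical all_reals all_analysis.

Set Implicit Arguments.
Unset Strict Implicit.
Unset Printing Implicit Defensive.

Import Order.TTheory GRing.Theory Num.Theory.
Import numFieldNormedType.Exports.

Local Open Scope classical_set_scope.
Local Open Scope ring_scope.

(* The canonical norm `|x| on matrices is the sup norm; lengths and
   orthogonality below always refer to the Euclidean structure given by dot. *)
Definition dot (R : realType) (u v : 'rV[R]_2) : R := (u *m v^T) 0 0.

Definition enorm (R : realType) (u : 'rV[R]_2) : R := Num.sqrt (dot u u).

Definition plane_convex_body (R : realType) (K : set 'rV[R]_2) : Prop :=
  [/\ compact K, convex_set K & K° !=set0].

Definition segment (R : realType) (a b : 'rV[R]_2) : set 'rV[R]_2 :=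
  [set a + t *: (b - a) | t in `[0, 1]].

(* A nondegenerate rectangle of arbitrary orientation, given by a vertex and the
   two edge vectors issuing from it. *)
Record rectangle (R : realType) := Rectangle {
  vertex : 'rV[R]_2;
  edge1 : 'rV[R]_2;
  edge2 : 'rV[R]_2;
  edge1_neq0 : edge1 != 0;
  edge2_neq0 : edge2 != 0;
  edges_orthogonal : dot edge1 edge2 = 0
}.

Definition rectangle_set (R : realType) (Q : rectangle R) : set 'rV[R]_2 :=
  [set vertex Q + s *: edge1 Q + t *: edge2 Q | s in `[0, 1] & t in `[0, 1]].

Definition rectangle_sides (R : realType) (Q : rectangle R) :
    set (set 'rV[R]_2) :=
  let a := vertex Q in
  let b := a + edge1 Q in
  let c := a + edge1 Q + edge2 Q in
  let d := a + edge2 Q in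
  [set segment a b; segment b c; segment c d; segment d a].

Definition is_square (R : realType) (Q : rectangle R) : Prop :=
  enorm (edge1 Q) = enorm (edge2 Q).

Definition circumscribed (R : realType) (Q : rectangle R)
    (K : set 'rV[R]_2) : Prop :=
  K `<=` rectangle_set Q /\
  forall S, rectangle_sides Q S -> (S `&` K) !=set0.

Definition strongly_invariant (R : realType) (K : set 'rV[R]_2) : Prop :=
  forall Q : rectangle R, circumscribed Q K -> is_square Q.

Definition central_symmetral (R : realType) (K : set 'rV[R]_2) :
    set 'rV[R]_2 :=
  [set 2^-1 *: (p - q) | p in K & q in K].

Definition rotation (R : realType) (theta : R) (x : 'rV[R]_2) : 'rV[R]_2 :=
  \row_j (if j == 0 then cos theta * x 0 0 - sin theta * x 0 1
          else sin theta * x 0 0 + cos theta * x 0 1).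

(* Symmetry about the origin is not required separately: it follows by applying
   the quarter turn twice. *)
Definition four_fold_symmetric (R : realType) (K : set 'rV[R]_2) : Prop :=
  rotation (pi / 2) @` K = K.

Definition AFF (R : realType) (K : set 'rV[R]_2) : set (set 'rV[R]_2) :=
  [set L | plane_convex_body L /\
     exists (A : 'M[R]_2) (b : 'rV[R]_2),
       A \in unitmx /\ L = [set x *m A + b | x in K]].

(* Orientation-reversing similarities are included. *)
Definition similarity (R : realType) (f : 'rV[R]_2 -> 'rV[R]_2) : Prop :=
  exists2 r : R, 0 < r & forall x y, enorm (f x - f y) = r * enorm (x - y).

Definition similar_sets (R : realType) (K L : set 'rV[R]_2) : Prop :=
  exists2 f : 'rV[R]_2 -> 'rV[R]_2, similarity f & L = f @` K.

(* Main.v *)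
(* Let C be the central symmetral of K, h its support function and J the
   quarter turn.  A rectangle with edge directions u and J u circumscribed about
   K has side lengths proportional to h(u) and h(J u), so K is strongly invariant
   iff h o J = h; by separation of points from compact convex sets this means
   J C = C.  For uniqueness, if C and C A are both J-invariant, then, since
   A J A^T = det A J, the symmetric map A A^T sends C onto (det A) C, and looking
   at a longest vector of C shows that A A^T is scalar. *)

Require Import Defs.
From mathcomp Require Import all_boot all_order all_algebra.
From mathcomp Require Import all_classical all_reals all_analysis.
From mathcomp Require Import ring lra.

Set Implicit Arguments.
Unset Strict Implicit.
Unset Printing Implicit Defensive.

Import Order.TTheory GRing.Theory Num.Theory.
Import numFieldNormedType.Exports.

Local Open Scope classical_set_scope.
Local Open Scope ring_scope.

Local Notation J := (rotation (pi / 2)).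

(** * Coordinates and the Euclidean structure of the plane *)

Lemma row2P (R : Type) (x y : 'rV[R]_2) :
  x 0 0 = y 0 0 -> x 0 1 = y 0 1 -> x = y.
Proof.
move=> e0 e1; apply/rowP => j.
case: (eqVneq j 0) => [->//|j0].
by have -> : j = 1 by case: j j0 => -[|[]]//= *; apply/val_inj.
Qed.

Lemma mulmx2E (R : pzSemiRingType) m n
    (A : 'M[R]_(m, 2)) (B : 'M[R]_(2, n)) i j :
  (A *m B) i j = A i 0 * B 0 j + A i 1 * B 1 j.
Proof.
rewrite !mxE !big_ord_recl big_ord0 addr0; congr (_ + _ * _).
  by congr (A i _); apply/val_inj.
by congr (B _ j); apply/val_inj.
Qed.

Section Plane.
Variable R : realType.
Implicit Types (x y z u v : 'rV[R]_2) (K C : set 'rV[R]_2).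

Lemma dotE u v : dot u v = u 0 0 * v 0 0 + u 0 1 * v 0 1.
Proof. by rewrite /dot mulmx2E !mxE. Qed.

Lemma quarter_turnE x : (J x 0 0 = - x 0 1) * (J x 0 1 = x 0 0).
Proof.
by rewrite !mxE /= sin_pihalf cos_pihalf !mul0r !mul1r add0r addr0.
Qed.

Lemma dot_gt0 u : u != 0 -> 0 < dot u u.
Proof.
move=> u0; rewrite dotE lt_neqAle addr_ge0 -?expr2 ?sqr_ge0// andbT eq_sym.
apply: contra_neq u0 => /eqP.
rewrite paddr_eq0 ?sqr_ge0// !sqrf_eq0 => /andP[/eqP u0 /eqP u1].
by apply: row2P; rewrite mxE.
Qed.

Lemma continuous_dot (T : topologicalType) (f g : T -> 'rV[R]_2) :
  continuous f -> continuous g -> continuous (fun t => dot (f t) (g t)).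
Proof.
move=> cf cg t.
have -> : (fun t => dot (f t) (g t)) =
    fun t => f t 0 0 * g t 0 0 + f t 0 1 * g t 0 1.
  by apply/funext => s; exact: dotE.
have coord (h : T -> 'rV[R]_2) j :
    continuous h -> h s 0 j @[s --> t] --> h t 0 j.
  by move=> ch; apply: (@continuous_comp _ _ _ h (fun M => M 0 j));
    [exact: ch|exact: coord_continuous].
by apply: cvgD; apply: cvgM; apply: coord.
Qed.

(** * Convexity and separation of a point *)

Lemma convex_setP K : convex_set K <->
  forall x y t, 0 <= t <= 1 -> K x -> K y -> K (x + t *: (y - x)).
Proof.
split=> [cK x y t /andP[t0 t1] Kx Ky|cK x y t].
  (* [conv] puts the weight on its first point, hence the swap. *)
  have := cK y x (Itv01 t0 t1); rewrite !inE => /(_ Ky Kx).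
  by congr K; rewrite /conv /=; apply: row2P; rewrite !mxE /unstable.onem; ring.
rewrite !inE => Kx Ky; have := cK y x t%:num; rewrite ge0 le1.
move=> /(_ isT Ky Kx); congr K.
by rewrite /conv /=; apply: row2P; rewrite !mxE /unstable.onem; ring.
Qed.

(** The normal is [y - p] for the point [p] of [C] nearest to [y]: moving from [p] towards [c]
    inside [C] cannot come closer to [y], so [c - p] makes no acute angle with [y - p]. *)
Lemma compact_convex_separation C y : C !=set0 -> compact C -> convex_set C ->
  ~ C y -> exists u, forall c, C c -> dot u c < dot u y.
Proof.
move=> C0 cC /convex_setP vC nCy.
have csub : continuous (fun x => x - y).
  move=> x.
  by apply: continuousB; [exact: cvg_id|exact: cst_continuous].
have [p pC minp] := EVT_min_rV C0 cC
  (continuous_subspaceT (continuous_dot csub csub)).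
move: pC; rewrite inE => pC; exists (y - p) => c Cc.
have yp : y - p != 0.
  by apply: contra_notN nCy; rewrite subr_eq0 => /eqP ->.
have {minp}step t : 0 <= t <= 1 ->
    2 * t * dot (y - p) (c - p) <= t ^+ 2 * dot (c - p) (c - p).
  move=> t01; have := minp _ (mem_set (vC _ _ _ t01 pC Cc)).
  by rewrite !dotE !mxE; lra.
suff: dot (y - p) (c - p) <= 0.
  by have := dot_gt0 yp; rewrite !dotE !mxE; lra.
rewrite leNgt; apply/negP => D0.
have [N0|] := ltP 0 (dot (c - p) (c - p)); last first.
  by have := step 1; rewrite ler01 lexx; lra.
(* [step] fails at the minimiser [D / N] of [t ^+ 2 * N - 2 * t * D] if that is at most 1, and at
   [t = 1] otherwise. *)
set D := dot (y - p) _ in step D0; set N := dot (c - p) _ in step N0.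
have [DN|ND] := leP D N; last by have := step 1; rewrite ler01 lexx; lra.
have := step (D / N).
rewrite ler_pdivrMr// mul1r DN (divr_ge0 (ltW D0) (ltW N0)) => /(_ isT).
have -> : 2 * (D / N) * D = 2 * (D * (D / N)) by ring.
have -> : (D / N) ^+ 2 * N = D * (D / N) by field; rewrite gt_eqF.
have : 0 < D * (D / N) by rewrite !mulr_gt0 ?invr_gt0.
lra.
Qed.

(** * Support functions and the central symmetral *)

Definition support K u : R := sup [set dot u x | x in K].

(** A maximiser excludes the empty and unbounded cases, where [sup] is a default value; later values
    of [support] all come from one. *)
Lemma support_max K u p : K p -> (forall x, K x -> dot u x <= dot u p) ->
  support K u = dot u p.
Proof.
move=> Kp maxp; apply/eqP; rewrite eq_le; apply/andP; split.
  by apply: ge_sup; [exists (dot u p), p|move=> _ [x Kx <-]; exact: maxp].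
by apply: ub_le_sup; [exists (dot u p) => _ [x Kx <-]; exact: maxp|exists p].
Qed.

Lemma support_attained K u : K !=set0 -> compact K ->
  exists p, [/\ K p, support K u = dot u p &
    forall x, K x -> dot u x <= dot u p].
Proof.
move=> K0 cK; have cdot : continuous (dot u).
  by apply: continuous_dot => x; [exact: cst_continuous|exact: cvg_id].
have [p /set_mem pK maxp] := EVT_max_rV K0 cK (continuous_subspaceT cdot).
have {}maxp x : K x -> dot u x <= dot u p by move=> Kx; apply/maxp/mem_set.
by exists p; split=> //; exact: support_max.
Qed.

Lemma dot_le_support K u x : compact K -> K x -> dot u x <= support K u.
Proof.
move=> cK Kx; have K0 : K !=set0 by exists x.
by have [p [_ -> ->]] := support_attained u K0 cK.
Qed.

(** The two points of a pair can be maximised independently. *)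
Lemma support_central_symmetral K u : K !=set0 -> compact K ->
  support (central_symmetral K) u = (support K u + support K (- u)) / 2.
Proof.
move=> K0 cK; have [p [Kp -> maxp]] := support_attained u K0 cK.
have [q [Kq -> maxq]] := support_attained (- u) K0 cK.
rewrite (@support_max _ _ (2^-1 *: (p - q))).
- by rewrite !dotE !mxE; field.
- by exists p => //; exists q.
move=> _ [x Kx [y Ky <-]]; have := maxp _ Kx; have := maxq _ Ky.
by rewrite !dotE !mxE; lra.
Qed.

Lemma compact_central_symmetral K : compact K -> compact (central_symmetral K).
Proof.
move=> cK.
have -> : central_symmetral K =
    [set 2^-1 *: (z.1 - z.2) | z in K `*` K].
  apply/seteqP; split=> [_ [p Kp [q Kq <-]]|_ [[p q] [/= Kp Kq] <-]].
    by exists (p, q).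
  by exists p => //; exists q.
apply: continuous_compact; last exact: compact_setX.
apply: continuous_subspaceT => z.
apply: (@continuous_comp _ _ _ (fun z : 'rV[R]_2 * 'rV[R]_2 => z.1 - z.2)
  (fun v => 2^-1 *: v)); last exact: scaler_continuous.
by apply: continuousB; [exact: cvg_fst|exact: cvg_snd].
Qed.

Lemma convex_central_symmetral K :
  convex_set K -> convex_set (central_symmetral K).
Proof.
move=> /convex_setP cK; apply/convex_setP.
move=> _ _ t t01 [a Ka [b Kb <-]] [c Kc [d Kd <-]].
exists (a + t *: (c - a)); first exact: cK.
exists (b + t *: (d - b)); first exact: cK.
by apply: row2P; rewrite !mxE; ring.
Qed.

Lemma central_symmetral_neq0 K : K !=set0 -> central_symmetral K !=set0.
Proof. by case=> x Kx; exists (2^-1 *: (x - x)), x => //; exists x. Qed.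

(** Differences cancel the translation. *)
Lemma central_symmetral_affine K (A : 'M[R]_2) b :
  central_symmetral [set x *m A + b | x in K] =
  [set x *m A | x in central_symmetral K].
Proof.
have affE p q : 2^-1 *: (p *m A + b - (q *m A + b)) = 2^-1 *: (p - q) *m A.
  by rewrite -scalemxAl mulmxBl opprD addrACA subrr addr0.
apply/seteqP; split=> [_ [_ [p Kp <-] [_ [q Kq <-] <-]]|
                       _ [_ [p Kp [q Kq <-]] <-]].
  by exists (2^-1 *: (p - q)) => //; exists p => //; exists q.
by exists (p *m A + b); [exists p|exists (q *m A + b)] => //; exists q.
Qed.

(** * The quarter turn and four-fold symmetry *)

Lemma dot_quarter_turn u v : dot (J u) (J v) = dot u v.
Proof. by rewrite !dotE !quarter_turnE; ring. Qed.

Lemma quarter_turn_sq x : J (J x) = - x.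
Proof. by apply: row2P; rewrite !(quarter_turnE, mxE). Qed.

(** A symmetry of [C] carries maximisers for [u] to maximisers for [J u]. Conversely, a direction
    separating [J x] from [C], turned back, would separate [x] from [C]. *)
Lemma four_fold_symmetricP C : C !=set0 -> compact C -> convex_set C ->
  four_fold_symmetric C <-> forall u, support C (J u) = support C u.
Proof.
move=> C0 cC vC; split=> [symC u|hC].
  have [p [Cp -> maxp]] := support_attained u C0 cC.
  rewrite -dot_quarter_turn; apply: support_max.
    by rewrite -symC; exists p.
  by rewrite -{1}symC => _ [x Cx <-]; rewrite !dot_quarter_turn; exact: maxp.
have JC x : C x -> C (J x).
  move=> Cx; apply: contrapT => nCJx.
  have [u sep] := compact_convex_separation C0 cC vC nCJx.
  have [p [Cp hp _]] := support_attained u C0 cC.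
  have := sep _ Cp; rewrite -hp -(hC u) -(hC (J u)) -(hC (J (J u))) ltNge.
  (* Three quarter turns are the inverse turn, the adjoint of [J]. *)
  have -> : dot u (J x) = dot (J (J (J u))) x.
    by rewrite !dotE !quarter_turnE; ring.
  by rewrite dot_le_support.
apply/seteqP; split=> [_ [x Cx <-]|x Cx]; first exact: JC.
exists (J (J (J x))); first exact: JC _ (JC _ (JC _ Cx)).
by rewrite !quarter_turn_sq opprK.
Qed.

(** * Circumscribed rectangles and widths *)

Lemma supportZ K u c : K !=set0 -> compact K -> 0 <= c ->
  support K (c *: u) = c * support K u.
Proof.
move=> K0 cK c0; have [p [Kp -> maxp]] := support_attained u K0 cK.
have cdot x : dot (c *: u) x = c * dot u x by rewrite !dotE !mxE; ring.
rewrite -cdot; apply: support_max => // x Kx.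
by rewrite !cdot ler_wpM2l// maxp.
Qed.

Lemma support_slab K u c w p q : (forall x, K x -> c <= dot u x <= c + w) ->
  K p -> dot u p = c -> K q -> dot u q = c + w ->
  support (central_symmetral K) u = w / 2.
Proof.
move=> slab Kp pc Kq qc; rewrite (@support_max _ _ (2^-1 *: (q - p))).
- by move: pc qc; rewrite !dotE !mxE; lra.
- by exists q => //; exists p.
move=> _ [x Kx [y Ky <-]]; have := slab _ Kx; have := slab _ Ky.
by move: pc qc; rewrite !dotE !mxE; lra.
Qed.

(** Two opposite sides are level lines of [dot (edge1 Q)] whose values differ by the squared length
    of that edge; they bound a strip that [K] touches on both edges. The other two sides do the same
    for [edge2 Q]. *)
Lemma circumscribed_support (Q : rectangle R) K : circumscribed Q K ->
  support (central_symmetral K) (edge1 Q) = dot (edge1 Q) (edge1 Q) / 2 /\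
  support (central_symmetral K) (edge2 Q) = dot (edge2 Q) (edge2 Q) / 2.
Proof.
case: Q => a e1 e2 e10 e20 orth [/= sub sides].
have [p1 [[t1 _ /= p1E] Kp1]] :=
  sides _ (or_introl (or_introl (or_introl erefl))).
have [p2 [[t2 _ /= p2E] Kp2]] :=
  sides _ (or_introl (or_introl (or_intror erefl))).
have [p3 [[t3 _ /= p3E] Kp3]] := sides _ (or_introl (or_intror erefl)).
have [p4 [[t4 _ /= p4E] Kp4]] := sides _ (or_intror erefl).
have d1 s t : dot e1 (a + s *: e1 + t *: e2) = dot e1 a + s * dot e1 e1.
  transitivity (dot e1 a + s * dot e1 e1 + t * dot e1 e2); last first.
    by rewrite orth mulr0 addr0.
  by rewrite !dotE !mxE; ring.
have d2 s t : dot e2 (a + s *: e1 + t *: e2) = dot e2 a + t * dot e2 e2.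
  transitivity (dot e2 a + s * dot e1 e2 + t * dot e2 e2); last first.
    by rewrite orth mulr0 addr0.
  by rewrite !dotE !mxE; ring.
split.
- apply: (@support_slab _ _ (dot e1 a) _ p4 p2) => //.
  + move=> x /sub[s /=]; rewrite in_itv/= => /andP[s0 s1] [t _ <-].
    by rewrite d1 lerDl lerD2l mulr_ge0 ?ler_piMl ?(ltW (dot_gt0 e10)).
  (* The third and fourth sides are traversed backwards, hence [1 - t4] here and [1 - t3] below. *)
  + have -> : p4 = a + 0 *: e1 + (1 - t4) *: e2.
      by rewrite -p4E; apply: row2P; rewrite !mxE; ring.
    by rewrite d1 mul0r addr0.
  + have -> : p2 = a + 1 *: e1 + t2 *: e2.
      by rewrite -p2E; apply: row2P; rewrite !mxE; ring.
    by rewrite d1 mul1r.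
- apply: (@support_slab _ _ (dot e2 a) _ p1 p3) => //.
  + move=> x /sub[s _ [t /=]]; rewrite in_itv/= => /andP[t0 t1'] <-.
    by rewrite d2 lerDl lerD2l mulr_ge0 ?ler_piMl ?(ltW (dot_gt0 e20)).
  + have -> : p1 = a + t1 *: e1 + 0 *: e2.
      by rewrite -p1E; apply: row2P; rewrite !mxE; ring.
    by rewrite d2 mul0r addr0.
  + have -> : p3 = a + (1 - t3) *: e1 + 1 *: e2.
      by rewrite -p3E; apply: row2P; rewrite !mxE; ring.
    by rewrite d2 mul1r.
Qed.

(** A short step along [u] from an interior point stays in [K]. This makes all widths of a body
    positive. *)
Lemma interior_separated_dot K u : K° !=set0 -> u != 0 ->
  exists x y, [/\ K x, K y & dot u x < dot u y].
Proof.
move=> [x Kx] u0.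
have cl : (fun t : R => x + t *: u) t @[t --> (0 : R)] --> x + (0 : R) *: u.
  by apply: cvgD; [exact: cvg_cst|apply: cvgZr_tmp; exact: cvg_id].
rewrite scale0r addr0 in cl.
have /nbhs_ballP[e /= e0 he] := cl _ Kx.
exists x, (x + (e / 2) *: u); split; first exact: interior_subset Kx.
  apply: he; rewrite /ball /= sub0r normrN gtr0_norm; lra.
have := mulr_gt0 (divr_gt0 e0 (ltr0n R 2)) (dot_gt0 u0).
by rewrite !dotE !mxE; lra.
Qed.

Lemma orthogonal_decomposition u x : u != 0 ->
  x = (dot u x / dot u u) *: u + (dot (J u) x / dot u u) *: J u.
Proof.
move=> /dot_gt0 n0; apply: row2P; rewrite !(quarter_turnE, mxE).
all: by move: n0; rewrite !dotE !quarter_turnE => n0; field; rewrite gt_eqF.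
Qed.

(** The rectangle is the intersection of the two narrowest strips around [K] orthogonal to [u] and
    [J u]. These vectors have equal length, so one factor [c] serves both edges. *)
Lemma circumscribed_exists K u : plane_convex_body K -> u != 0 ->
  exists2 Q : rectangle R, circumscribed Q K &
    exists2 c : R, 0 < c &
      edge1 Q = (c * support (central_symmetral K) u) *: u /\
      edge2 Q = (c * support (central_symmetral K) (J u)) *: J u.
Proof.
move=> [cK _ iK] u0.
have Ju0 : J u != 0.
  apply: contra_neq u0 => Ju0.
  by rewrite -[u]opprK -(quarter_turn_sq u) Ju0; apply: row2P;
     rewrite !(quarter_turnE, mxE) ?oppr0.
have K0 : K !=set0 by case: iK => x /interior_subset Kx; exists x.
have slab v : v != 0 -> exists p q, [/\ K p, K q, dot v p < dot v q,
    (forall x, K x -> dot v p <= dot v x <= dot v q) &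
    support (central_symmetral K) v = (dot v q - dot v p) / 2].
  move=> v0; have [q [Kq _ maxq]] := support_attained v K0 cK.
  have [p [Kp _ maxp]] := support_attained (- v) K0 cK.
  have bnd x : K x -> dot v p <= dot v x <= dot v q.
    move=> Kx; rewrite maxq// andbT.
    by have := maxp _ Kx; rewrite !dotE !mxE; lra.
  exists p, q; split => //.
    have [x [y [Kx Ky xy]]] := interior_separated_dot iK v0.
    have /andP[px _] := bnd _ Kx; have /andP[_ yq] := bnd _ Ky.
    exact: le_lt_trans px (lt_le_trans xy yq).
  by apply: (@support_slab _ _ (dot v p) _ p q) => //; rewrite addrC subrK.
have [p1 [q1 [Kp1 Kq1 w1 slab1 ->]]] := slab u u0.
have [p2 [q2 [Kp2 Kq2 w2 slab2 ->]]] := slab (J u) Ju0.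
have n0 := dot_gt0 u0; set n := dot u u in n0.
pose w := dot u q1 - dot u p1; pose h := dot (J u) q2 - dot (J u) p2.
have w0 : 0 < w by rewrite subr_gt0.
have h0 : 0 < h by rewrite subr_gt0.
(* The corner where [dot u] and [dot (J u)] both equal their minimum over [K]. *)
pose a := (dot u p1 / n) *: u + (dot (J u) p2 / n) *: J u.
have e1_neq0 : (w / n) *: u != 0.
  by rewrite scaler_eq0 negb_or u0 gt_eqF ?divr_gt0.
have e2_neq0 : (h / n) *: J u != 0.
  by rewrite scaler_eq0 negb_or Ju0 gt_eqF ?divr_gt0.
have orth : dot ((w / n) *: u) ((h / n) *: J u) = 0.
  by rewrite !dotE !(quarter_turnE, mxE); ring.
pose Q := Rectangle a e1_neq0 e2_neq0 orth.
have coordE x : x = a + ((dot u x - dot u p1) / w) *: ((w / n) *: u)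
    + ((dot (J u) x - dot (J u) p2) / h) *: ((h / n) *: J u).
  rewrite !scalerA {1}(orthogonal_decomposition x u0) -/n /a.
  have cancel c k : k != 0 -> c / k * (k / n) = c / n.
    by move=> k0; rewrite mulrA divfK.
  by rewrite !cancel ?gt_eqF//; apply: row2P; rewrite !mxE; ring.
have frac v p q x : dot v p < dot v q -> dot v p <= dot v x <= dot v q ->
    (dot v x - dot v p) / (dot v q - dot v p) \in `[0, 1].
  move=> pq /andP[px xq]; rewrite in_itv/= divr_ge0 ?subr_ge0 ?(ltW pq)//=.
  by rewrite ler_pdivrMr ?subr_gt0// mul1r lerD2r.
exists Q; last first.
  exists (2 / n); first by rewrite divr_gt0.
  by rewrite /= -/w -/h; split; congr (_ *: _); field; rewrite gt_eqF.
split=> [x Kx|S] /=.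
  exists ((dot u x - dot u p1) / w); first exact/frac/slab1.
  exists ((dot (J u) x - dot (J u) p2) / h); first exact/frac/slab2.
  by rewrite -coordE.
have vv0 v p (k : R) : (dot v p - dot v p) / k = 0 by rewrite subrr mul0r.
have w_1 : w / w = 1 by rewrite divff ?gt_eqF.
have h_1 : h / h = 1 by rewrite divff ?gt_eqF.
(* In the order of the sides, the touching points are [p2], [q1], [q2], [p1]; the last two sides run
   backwards. *)
move=> [[[]|]|] ->.
- exists p2; split=> //; exists ((dot u p2 - dot u p1) / w).
    exact/frac/slab1.
  by rewrite [RHS]coordE vv0; apply: row2P; rewrite !mxE; ring.
- exists q1; split=> //; exists ((dot (J u) q1 - dot (J u) p2) / h).
    exact/frac/slab2.
  by rewrite [RHS]coordE -/w w_1; apply: row2P; rewrite !mxE; ring.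
- exists q2; split=> //; exists (1 - (dot u q2 - dot u p1) / w).
    have := frac _ _ _ _ w1 (slab1 _ Kq2).
    by rewrite /= !in_itv/= -/w => /andP[? ?]; apply/andP; split; lra.
  by rewrite [RHS]coordE -/h h_1; apply: row2P; rewrite !mxE; ring.
- exists p1; split=> //; exists (1 - (dot (J u) p1 - dot (J u) p2) / h).
    have := frac _ _ _ _ w2 (slab2 _ Kp1).
    by rewrite /= !in_itv/= -/h => /andP[? ?]; apply/andP; split; lra.
  by rewrite [RHS]coordE vv0; apply: row2P; rewrite !mxE; ring.
Qed.

(** A rectangle circumscribed along [u] and [J u] is a square only if the two support values agree.
    Conversely, if [edge2 Q] is [c *: J (edge1 Q)], invariance makes the ratio of squared edge
    lengths [|c|], while it is also [c ^+ 2]; so [|c|] is 1. *)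
Lemma strongly_invariant_support K : plane_convex_body K ->
  strongly_invariant K <->
  forall u, support (central_symmetral K) (J u) =
            support (central_symmetral K) u.
Proof.
move=> bK; have [cK vK iK] := bK.
have K0 : K !=set0 by case: iK => x /interior_subset Kx; exists x.
have C0 := central_symmetral_neq0 K0.
have cC := compact_central_symmetral cK.
split=> [siK u|hC Q /circumscribed_support[]].
  have [->|u0] := eqVneq u 0.
    by congr support; apply: row2P; rewrite !(quarter_turnE, mxE) ?oppr0.
  have [Q /siK sqQ [c c0 [e1E e2E]]] := circumscribed_exists bK u0.
  (* The symmetral contains the origin. *)
  have pos v : 0 <= support (central_symmetral K) v.
    have [x Kx] := K0; have /(dot_le_support v cC) :
      central_symmetral K (2^-1 *: (x - x)) by exists x => //; exists x.
    by rewrite subrr scaler0 dotE !mxE !mulr0 addr0.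
  have normE (k : R) v : 0 <= k -> enorm (k *: v) = k * enorm v.
    move=> k0; rewrite /enorm.
    have -> : dot (k *: v) (k *: v) = k ^+ 2 * dot v v.
      by rewrite !dotE !mxE; ring.
    by rewrite sqrtrM ?sqr_ge0// sqrtr_sqr ger0_norm.
  move: sqQ; rewrite /is_square e1E e2E !normE ?mulr_ge0 ?(ltW c0)//.
  rewrite {2}/enorm dot_quarter_turn -/(enorm u).
  have nu0 : enorm u != 0 by rewrite /enorm sqrtr_eq0 -ltNge dot_gt0.
  by move/(mulIf nu0)/(mulfI (lt0r_neq0 c0)).
case: Q => a e1 e2 e10 e20 orth /= s1 s2; rewrite /is_square /=.
have Je1 := orthogonal_decomposition e2 e10.
rewrite orth mul0r scale0r add0r in Je1.
set c := _ / _ in Je1.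
have n1 := dot_gt0 e10; have n2 := dot_gt0 e20.
have e2sq : dot e2 e2 = c ^+ 2 * dot e1 e1.
  by rewrite -dot_quarter_turn Je1 !dotE !(quarter_turnE, mxE); ring.
have normc : dot e2 e2 = `|c| * dot e1 e1.
  suff : support (central_symmetral K) e2 =
         `|c| * support (central_symmetral K) e1 by rewrite s1 s2; lra.
  rewrite Je1; have [c0|/ltW c0] := leP 0 c.
    by rewrite supportZ// hC ger0_norm.
  (* For negative [c], [c *: J e1] is [- c] times three quarter turns of [e1]. *)
  rewrite -[c]opprK scaleNr -scalerN -quarter_turn_sq.
  by rewrite supportZ ?oppr_ge0// !hC normrN ger0_norm ?oppr_ge0.
rewrite /enorm normc; congr Num.sqrt.
have c1 : `|c| != 0.
  by move: n2; rewrite normc; case: eqP => // ->; rewrite mul0r ltxx.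
have : `|c| * `|c| = `|c| * 1.
  apply: (mulIf (lt0r_neq0 n1)); rewrite mulr1 -normc e2sq -expr2.
  by rewrite real_normK ?num_real.
by move/(mulfI c1) ->; rewrite mul1r.
Qed.

(** * Linear maps between four-fold symmetric sets *)

(** Determinant [e ^+ 2] and eigenvalue [e] make [e] a double eigenvalue, and a symmetric matrix
    with a double eigenvalue is scalar. *)
Lemma symmetric_mx2_scalar (p q s e v0 v1 : R) :
  p * s - q ^+ 2 = e ^+ 2 -> e != 0 -> (v0 != 0) || (v1 != 0) ->
  p * v0 + q * v1 = e * v0 -> q * v0 + s * v1 = e * v1 ->
  [/\ p = e, q = 0 & s = e].
Proof.
move=> detE e0 v00 eq0 eq1.
have det0 : (p - e) * (s - e) - q ^+ 2 = 0.
  case/orP: v00 => v00; apply: (mulIf v00); rewrite mul0r.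
    transitivity ((s - e) * (p * v0 + q * v1 - e * v0) -
                  q * (q * v0 + s * v1 - e * v1)); first ring.
    by rewrite eq0 eq1 !subrr !mulr0 subrr.
  transitivity ((p - e) * (q * v0 + s * v1 - e * v1) -
                q * (p * v0 + q * v1 - e * v0)); first ring.
  by rewrite eq0 eq1 !subrr !mulr0 subrr.
have trE : p + s = 2 * e.
  by apply: (mulfI e0); move: det0 detE; rewrite expr2; lra.
(* By the trace, [p - e = - (s - e)], which turns [det0] into a vanishing sum of squares. *)
have /eqP : (p - e) ^+ 2 + q ^+ 2 = 0.
  have -> : p - e = - (s - e) by lra.
  move: det0; have -> : p - e = - (s - e) by lra.
  by rewrite expr2; lra.
rewrite paddr_eq0 ?sqr_ge0// !sqrf_eq0 subr_eq0 => /andP[/eqP pe /eqP q0].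
by split=> //; lra.
Qed.

(** The symmetric matrix [A *m A^T] has determinant [d ^+ 2] and an eigenvalue [d] or [- d], so it
    is scalar. The given nonzero point keeps a longest vector of [C] from vanishing. *)
Lemma four_fold_conformal C (A : 'M[R]_2) : compact C ->
  (exists2 x, C x & x != 0) -> A \in unitmx ->
  four_fold_symmetric C -> four_fold_symmetric [set x *m A | x in C] ->
  exists2 e : R, 0 < e & forall x, dot (x *m A) (x *m A) = e * dot x x.
Proof.
move=> cC [x0 Cx0 x00] uA symC symCA.
pose f x := x *m A *m A^T; pose d := A 0 0 * A 1 1 - A 0 1 * A 1 0.
(* [d] is the determinant of [A], and its product with that of the inverse is 1. *)
have d0 : d != 0.
  pose B := invmx A.
  have AB i j : A i 0 * B 0 j + A i 1 * B 1 j = (1%:M : 'M[R]_2) i j.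
    by rewrite -mulmx2E mulmxV.
  have : d * (B 0 0 * B 1 1 - B 0 1 * B 1 0) = 1.
    transitivity
      ((A 0 0 * B 0 0 + A 0 1 * B 1 0) * (A 1 0 * B 0 1 + A 1 1 * B 1 1) -
       (A 0 0 * B 0 1 + A 0 1 * B 1 1) * (A 1 0 * B 0 0 + A 1 1 * B 1 0)).
      by rewrite /d; ring.
    by rewrite !AB !mxE /=; ring.
  by apply: contra_eqN => /eqP ->; rewrite mul0r eq_sym oner_neq0.
have fJ x : J (x *m A) *m A^T = d *: J x.
  by apply: row2P; rewrite !(mulmx2E, quarter_turnE, mxE) /d; ring.
have Cf x : C x -> exists2 z, C z & f x = d *: z.
  move=> Cx; have : [set x *m A | x in C] (x *m A) by exists x.
  rewrite -{1}symCA => -[_ [x' Cx' <-] xA].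
  by exists (J x'); [rewrite -symC; exists x'|rewrite /f -xA fJ].
have fC z : C z -> exists2 x, C x & f x = d *: z.
  rewrite -{1}symC => -[x' Cx' <-].
  have : [set x *m A | x in C] (J (x' *m A)).
    by rewrite -symCA; exists (x' *m A) => //; exists x'.
  by move=> [x Cx xA]; exists x => //; rewrite /f xA fJ.
have fsym x y : dot (f x) y = dot x (f y).
  by rewrite !dotE /f !mulmx2E !mxE; ring.
have cid : continuous (fun x : 'rV[R]_2 => x) by move=> x; exact: cvg_id.
have [y /set_mem Cy maxy] := EVT_max_rV (ex_intro _ _ Cx0) cC
  (continuous_subspaceT (continuous_dot cid cid)).
have {}maxy x : C x -> dot x x <= dot y y by move=> Cx; apply/maxy/mem_set.
have y0 : 0 < dot y y by exact: lt_le_trans (dot_gt0 x00) (maxy _ Cx0).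
have [x Cx fx] := fC _ Cy; have [z Cz fy] := Cf _ Cy.
have dotZ (k : R) u v : dot u (k *: v) = k * dot u v.
  by rewrite !dotE !mxE; ring.
have dotC u v : dot u v = dot v u by rewrite !dotE; ring.
(* Self-adjointness: [d * dot x z = dot x (f y) = dot (f x) y = d * dot y y]. *)
have xz : dot x z = dot y y.
  apply: (mulfI d0); rewrite -!dotZ -fy -fx.
  by rewrite -fsym fx dotC.
(* [z] and [x] are no longer than [y] while [dot x z = dot y y]. *)
have {Cf fC} zx : z = x.
  apply/eqP; rewrite -subr_eq0; apply: contraT => /dot_gt0.
  have := maxy _ Cx; have := maxy _ Cz; move: xz; rewrite !dotE !mxE; lra.
rewrite {z Cz xz}zx in fy.
(* [f] exchanges the lines of [x] and [y], so [x + y] and [x - y] are eigenvectors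
   unless they vanish. *)
have [v [e [v0 eE fv]]] :
    exists v e, [/\ v != 0, e ^+ 2 = d ^+ 2 & f v = e *: v].
  have [xy|xy] := eqVneq (x + y) 0; last first.
    exists (x + y), d; split=> //.
    by rewrite /f !mulmxDl -!/(f _) fx fy scalerDr addrC.
  exists y, (- d); split; rewrite ?sqrrN//.
    by apply: contraTneq y0 => ->; rewrite dotE !mxE !mul0r addr0 ltxx.
  rewrite fy (_ : x = - y) ?scalerN ?scaleNr//.
  by apply/eqP; rewrite -addr_eq0 xy.
have e0 : e != 0 by rewrite -sqrf_eq0 eE sqrf_eq0.
(* The entries of [A *m A^T]. *)
pose p := A 0 0 ^+ 2 + A 0 1 ^+ 2; pose q := A 0 0 * A 1 0 + A 0 1 * A 1 1.
pose s := A 1 0 ^+ 2 + A 1 1 ^+ 2.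
have f0 w : f w 0 0 = p * w 0 0 + q * w 0 1.
  by rewrite /f !mulmx2E !mxE /p /q; ring.
have f1 w : f w 0 1 = q * w 0 0 + s * w 0 1.
  by rewrite /f !mulmx2E !mxE /s /q; ring.
have [pe q0 se] : [/\ p = e, q = 0 & s = e].
  apply: (@symmetric_mx2_scalar p q s e (v 0 0) (v 0 1)) => //.
  - by rewrite eE /p /q /s /d; ring.
  - by rewrite -negb_and; apply: contra v0 => /andP[/eqP ? /eqP ?];
       apply/eqP/row2P; rewrite mxE.
  - by rewrite -f0 fv mxE.
  - by rewrite -f1 fv mxE.
(* The sign of [e] is that of [p], a sum of two squares. *)
exists e; first by rewrite lt_neqAle eq_sym e0 -pe /p addr_ge0 ?sqr_ge0.
move=> w; transitivity (dot w (f w)).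
  by rewrite !dotE /f !mulmx2E !mxE; ring.
by rewrite !dotE f0 f1 pe q0 se; ring.
Qed.

Lemma strongly_invariantP K : plane_convex_body K ->
  strongly_invariant K <-> four_fold_symmetric (central_symmetral K).
Proof.
move=> bK; have [cK vK [x /interior_subset Kx]] := bK.
apply: (iff_trans (strongly_invariant_support bK)); apply: iff_sym.
apply: four_fold_symmetricP.
- by apply: central_symmetral_neq0; exists x.
- exact: compact_central_symmetral.
- exact: convex_central_symmetral.
Qed.

End Plane.

Theorem theorem1 (R : realType) (K : set 'rV[R]_2)
    (hK : plane_convex_body K) :
  (strongly_invariant K <-> four_fold_symmetric (central_symmetral K)) /\
  (forall L M : set 'rV[R]_2,
     AFF K L -> AFF K M ->
     strongly_invariant L -> strongly_invariant M -> similar_sets L M).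
Proof.
split; first exact: strongly_invariantP.
move=> L M [bL [A1 [b1 [uA1 LE]]]] [bM [A2 [b2 [uA2 ME]]]].
move=> /(strongly_invariantP bL) symL /(strongly_invariantP bM) symM.
(* [f] undoes the affine map producing [L] and applies the one producing [M]. *)
pose A := invmx A1 *m A2; pose f x := x *m A + (b2 - b1 *m A).
have uA : A \in unitmx by rewrite unitmx_mul unitmx_inv uA1.
have MfL : M = f @` L.
  have fE x : f (x *m A1 + b1) = x *m A2 + b2.
    by rewrite /f mulmxDl addrACA subrr addr0 -mulmxA mulKVmx.
  rewrite LE ME; apply/seteqP; split=> [_ [x Kx <-]|_ [_ [x Kx <-] <-]].
    by exists (x *m A1 + b1) => //; exists x.
  by exists x.
have [cL vL iL] := bL.
have [x Lx x0] : exists2 x, central_symmetral L x & x != 0.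
  (* An arbitrary nonzero direction, along which [L] has positive width. *)
  have u0 : (const_mx 1 : 'rV[R]_2) != 0.
    by apply/eqP => /matrixP/(_ 0 0)/eqP; rewrite !mxE oner_eq0.
  have [x [y [Lx Ly xy]]] := interior_separated_dot iL u0.
  exists (2^-1 *: (x - y)); first by exists x => //; exists y.
  rewrite scaler_eq0 negb_or invr_eq0 pnatr_eq0 subr_eq0 /=.
  by apply: contraTneq xy => ->; rewrite ltxx.
rewrite MfL central_symmetral_affine in symM.
have [e e0 eE] := four_fold_conformal (compact_central_symmetral cL)
  (ex_intro2 _ _ _ Lx x0) uA symL symM.
exists f => //; exists (Num.sqrt e); first by rewrite sqrtr_gt0.
move=> y z; rewrite /f opprD addrACA subrr addr0 -mulmxBl /enorm eE.
by rewrite sqrtrM// ltW.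
Qed.
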